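(* Let $n$ be even and $F\colon\mathbb F_2^n\to\mathbb F_2^n$ a plateaued APN function. If $|\mathrm{Im}(F)|=\frac{2^n+2}{3}$, then $F$ has no balanced component functions.
   Context: Scalar product $\langle x,y\rangle=\sum x_iy_i$; component functions $F_b(x)=\langle b,F(x)\rangle$ for $b\ne0$; $W_f(a)=\sum_x(-1)^{f(x)+\langle a,x\rangle}$. $f$ is $t$-plateaued if $|W_f(a)|\in\{0,2^{(n+t)/2}\}$ for all $a$; $f$ is balanced if it takes value $0$ exactly $2^{n-1}$ times. $F$ is plateaued if each $F_b$, $b\ne0$, is $s_b$-plateaued for some $s_b$. $F$ is APN if for all $a\ne0$ and all $b$ the equation $F(x+a)+F(x)=b$ has at most $2$ solutions. $\mathrm{Im}(F)$ is the image set. *)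

(* Defs.v *)
From HB Require Import structures.
From mathcomp Require Import all_boot all_order all_algebra all_field.

Set Implicit Arguments.
Unset Strict Implicit.
Unset Printing Implicit Defensive.

Import Order.TTheory GRing.Theory Num.Theory.
Local Open Scope ring_scope.

Definition dotp (n : nat) (x y : 'rV['F_2]_n) : 'F_2 :=
  \sum_(i < n) x 0 i * y 0 i.

Definition component (n : nat) (F : 'rV['F_2]_n -> 'rV['F_2]_n)
    (b : 'rV['F_2]_n) : 'rV['F_2]_n -> 'F_2 :=
  fun x => dotp b (F x).

(* The exponent is computed in 'F_2 and then read as the natural number
   0 or 1 through the coercion of ordinals. *)
Definition walsh (n : nat) (f : 'rV['F_2]_n -> 'F_2) (a : 'rV['F_2]_n) : int :=
  \sum_(x : 'rV['F_2]_n) (-1) ^+ (f x + dotp a x)%R.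

(* The value 2 ^ ((n + t) / 2), irrational when n + t is odd, is the square
   root of 2 ^ (n + t) in the algebraic numbers. *)
Definition is_plateaued (n t : nat) (f : 'rV['F_2]_n -> 'F_2) : Prop :=
  forall a : 'rV['F_2]_n,
    `|(walsh f a)%:~R : algC| = 0 \/
    `|(walsh f a)%:~R : algC| = sqrtC (2 ^+ (n + t)).

(* Doubled so as not to use a truncated n - 1 when n = 0. *)
Definition balanced (n : nat) (f : 'rV['F_2]_n -> 'F_2) : Prop :=
  (2 * #|[set x | f x == 0%R]| = 2 ^ n)%N.

Definition plateaued (n : nat) (F : 'rV['F_2]_n -> 'rV['F_2]_n) : Prop :=
  forall b : 'rV['F_2]_n, b != 0 -> exists s : nat, is_plateaued s (component F b).

Definition APN (n : nat) (F : 'rV['F_2]_n -> 'rV['F_2]_n) : Prop :=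
  forall a b : 'rV['F_2]_n, a != 0 ->
    (#|[set x | (F (x + a) + F x == b)%R]| <= 2)%N.

Definition im_set (n : nat) (F : 'rV['F_2]_n -> 'rV['F_2]_n) : {set 'rV['F_2]_n} :=
  F @: [set: 'rV['F_2]_n].

(* Main.v *)
(** Write [A_b = 2 ^ (n + s_b)] for the nonzero value of [W_b ^ 2], where [W_b]
    is the Walsh transform of [F_b].  The fourth moment of the Walsh transform
    counts the quadruples with [x + y + z + w = 0] and
    [F x + F y + F z + F w = 0]; for a plateaued APN map this bounds the sum
    of the [A_b], [b <> 0], by [2 ^ (n + 1) * (2 ^ n - 1)].  The sum of the
    [W_b(0) ^ 2] counts collisions [F x = F y], and the size of the image,
    through [(k - 2) * (k - 3) >= 0] for the fibre sizes [k], makes it at least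
    [2 ^ (n + 1) * (2 ^ n - 2)].  As [W_b(0) = 0] for a balanced component, its
    [A_b] is at most the difference [2 ^ (n + 1)].  But such a component is not
    bent, so [A_b > 2 ^ n], and [A_b] is a square, so [A_b >= 2 ^ (n + 2)]. *)
Require Import Defs.
From mathcomp Require Import all_boot all_order all_algebra all_field.
From mathcomp Require Import zify ring.

Set Implicit Arguments.
Unset Strict Implicit.

Import Order.TTheory Num.Theory.
Import GRing.Theory.
Local Open Scope ring_scope.

(** * Characters of ['F_2 ^ n] and their orthogonality *)

Definition chi (c : 'F_2) : int := (-1) ^+ c.

Lemma chi0 : chi 0 = 1. Proof. by []. Qed.

Lemma chiD (c d : 'F_2) : chi (c + d) = chi c * chi d.
Proof. by case: c d => [[|[|c]] //= ?] [[|[|d]] //= ?]. Qed.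

Lemma dotp0 n (a : 'rV['F_2]_n) : dotp a 0 = 0.
Proof. by rewrite /dotp big1 // => i _; rewrite mxE mulr0. Qed.

Lemma dotpC n (a b : 'rV['F_2]_n) : dotp a b = dotp b a.
Proof. by apply: eq_bigr => i _; rewrite mulrC. Qed.

Lemma dotpDr n (a x y : 'rV['F_2]_n) : dotp a (x + y) = dotp a x + dotp a y.
Proof. by rewrite -big_split; apply: eq_bigr => i _; rewrite mxE mulrDr. Qed.

Lemma dotpDl n (a x y : 'rV['F_2]_n) : dotp (x + y) a = dotp x a + dotp y a.
Proof. by rewrite !(dotpC _ a) dotpDr. Qed.

Lemma F2_addrr n (x : 'rV['F_2]_n) : x + x = 0.
Proof. by apply/rowP => i; rewrite !mxE; case: (x 0 i) => [[|[|c]] //= ?]; apply/val_inj. Qed.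

Lemma F2_oppr n (x : 'rV['F_2]_n) : - x = x.
Proof. by apply/eqP; rewrite eq_sym -addr_eq0 F2_addrr. Qed.

Lemma F2_addr_eq0 n (x y : 'rV['F_2]_n) : (x + y == 0) = (x == y).
Proof. by rewrite addr_eq0 F2_oppr. Qed.

Lemma card_rV_F2 n : #|{: 'rV['F_2]_n}| = (2 ^ n)%N.
Proof. by rewrite card_mx mul1n card_ord. Qed.

Lemma card_neq_rV_F2 n (x : 'rV['F_2]_n) :
  #|(fun y : 'rV['F_2]_n => y != x)| = (2 ^ n).-1.
Proof. by rewrite -card_rV_F2 -(cardC1 x); apply: eq_card. Qed.

(** If [x] has a nonzero coordinate [i], translating [b] by the [i]-th unit vector flips every sign,
    so the sum equals its own opposite. *)
Lemma sum_chi_dotp n (x : 'rV['F_2]_n) :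
  \sum_b chi (dotp b x) = if x == 0 then 2 ^+ n else 0.
Proof.
case: eqP => [->|/eqP /rV0Pn[i xi]].
  under eq_bigr do rewrite dotp0 chi0.
  by rewrite sumr_const card_rV_F2 natrX.
have di : dotp (delta_mx 0 i) x = 1.
  rewrite /dotp (bigD1 i) //= big1 => [|j /negPf ji].
    by rewrite mxE !eqxx mul1r addr0; case: (x 0 i) xi => [[|[|c]] //= ?] _; apply/val_inj.
  by rewrite mxE eqxx ji mul0r.
have : \sum_b chi (dotp b x) = - \sum_b chi (dotp b x).
  rewrite {1}(reindex_inj (addrI (delta_mx 0 i))) -sumrN /=.
  by apply: eq_bigr => b _; rewrite dotpDl di chiD mulN1r.
lia.
Qed.

(** Orthogonality in the form behind every moment below: summing over [b] acts as a detector of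
    [G t = 0]. *)
Lemma sum_chi_weighted n (T : finType) (P : pred T) (c : T -> int)
    (G : T -> 'rV['F_2]_n) :
  \sum_b \sum_(t | P t) c t * chi (dotp b (G t)) =
  2 ^+ n * \sum_(t | P t && (G t == 0)) c t.
Proof.
rewrite exchange_big /= mulr_sumr big_mkcondr /=; apply: eq_bigr => t _.
by rewrite -mulr_sumr sum_chi_dotp; case: ifP; rewrite ?mulr0 // mulrC.
Qed.

(** * Moments of the Walsh transform *)

Lemma walshE n (f : 'rV['F_2]_n -> 'F_2) a :
  walsh f a = \sum_x chi (f x) * chi (dotp a x).
Proof. by apply: eq_bigr => x _; rewrite -chiD. Qed.

Lemma walsh_sqr n (f : 'rV['F_2]_n -> 'F_2) a :
  walsh f a ^+ 2 =
  \sum_(p : 'rV['F_2]_n * 'rV['F_2]_n)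
    chi (f p.1 + f p.2) * chi (dotp a (p.1 + p.2)).
Proof.
rewrite expr2 walshE big_distrlr /= pair_bigA /=.
by apply: eq_bigr => p _; rewrite dotpDr !chiD mulrACA.
Qed.

Lemma parseval n (f : 'rV['F_2]_n -> 'F_2) :
  \sum_a walsh f a ^+ 2 = 2 ^+ n * 2 ^+ n.
Proof.
under eq_bigr do rewrite walsh_sqr.
rewrite (sum_chi_weighted (fun=> true) (fun p => chi (f p.1 + f p.2))
  (fun p : 'rV__ * 'rV__ => p.1 + p.2)) /=.
under eq_bigl do rewrite F2_addr_eq0.
rewrite -(pair_big_dep (fun=> true) (fun x y => x == y)
  (fun x y => chi (f x + f y))) /=.
congr (_ * _); under eq_bigr => x _.
  under eq_bigl do rewrite eq_sym.
  rewrite big_pred1_eq.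
  have -> : chi (f x + f x) = 1 by case: (f x) => [[|[|c]] //= ?].
  over.
by rewrite sumr_const card_rV_F2 natrX.
Qed.

Definition collisions n (F : 'rV['F_2]_n -> 'rV['F_2]_n) :=
  [set p : 'rV['F_2]_n * 'rV['F_2]_n | F p.1 == F p.2].

Lemma sum_walsh0_sqr n (F : 'rV['F_2]_n -> 'rV['F_2]_n) :
  \sum_b walsh (component F b) 0 ^+ 2 = 2 ^+ n * #|collisions F|%:R.
Proof.
transitivity (\sum_b \sum_(p : 'rV['F_2]_n * 'rV['F_2]_n)
    1 * chi (dotp b (F p.1 + F p.2))).
  apply: eq_bigr => b _; rewrite walsh_sqr; apply: eq_bigr => p _.
  by rewrite [dotp 0 _]dotpC dotp0 chi0 mulr1 mul1r /component -dotpDr.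
rewrite (sum_chi_weighted (fun=> true) (fun=> 1)
  (fun p : 'rV__ * 'rV__ => F p.1 + F p.2)) sumr_const.
congr (_ * _%:R); apply: eq_card => p.
by rewrite !inE; apply: F2_addr_eq0.
Qed.

Definition vanishing_quadruples n (F : 'rV['F_2]_n -> 'rV['F_2]_n) :=
  [set t : ('rV['F_2]_n * 'rV['F_2]_n) * ('rV['F_2]_n * 'rV['F_2]_n) |
    (t.1.1 + t.1.2 + (t.2.1 + t.2.2) == 0) &&
    (F t.1.1 + F t.1.2 + (F t.2.1 + F t.2.2) == 0)].

Lemma sum_walsh_pow4 n (F : 'rV['F_2]_n -> 'rV['F_2]_n) :
  \sum_b \sum_a walsh (component F b) a ^+ 4 =
  2 ^+ n * 2 ^+ n * #|vanishing_quadruples F|%:R.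
Proof.
pose T : finType := (('rV['F_2]_n * 'rV['F_2]_n) * ('rV['F_2]_n * 'rV['F_2]_n))%type.
pose G (t : T) := t.1.1 + t.1.2 + (t.2.1 + t.2.2).
pose H (t : T) := F t.1.1 + F t.1.2 + (F t.2.1 + F t.2.2).
transitivity (\sum_b 2 ^+ n * \sum_(t : T | G t == 0) 1 * chi (dotp b (H t))).
  apply: eq_bigr => b _.
  (* Orthogonality is used twice: the sum over [a] forces [G t = 0], then the sum over [b] forces
     [H t = 0]. *)
  transitivity (\sum_a \sum_(t : T) chi (dotp b (H t)) * chi (dotp a (G t))).
    apply: eq_bigr => a _.
    rewrite (exprM _ 2 2) walsh_sqr expr2 big_distrlr /= pair_bigA /=.
    by apply: eq_bigr => t _; rewrite mulrACA -!chiD /component -!dotpDr.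
  rewrite (sum_chi_weighted (fun=> true)) /=.
  by under [in RHS]eq_bigr do rewrite mul1r.
rewrite -mulr_sumr (sum_chi_weighted (fun t => G t == 0)) sumr_const mulrA.
by congr (_ * _%:R); apply: eq_card => t; rewrite inE.
Qed.

(** Given [x] and [y], a quadruple is determined by [z], since [w = z + (x + y)], and [z] solves a
    derivative equation in direction [x + y]. There are at most 2 such [z] if [x <> y], and at most
    [2 ^ n] if [x = y]. *)
Lemma card_vanishing_quadruples n (F : 'rV['F_2]_n -> 'rV['F_2]_n) :
  APN F ->
  (#|vanishing_quadruples F| + 2 * 2 ^ n <= 3 * (2 ^ n * 2 ^ n))%N.
Proof.
move=> F_APN.
pose D (p : 'rV['F_2]_n * 'rV['F_2]_n) :=
  [set z | F (z + (p.1 + p.2)) + F z == F p.1 + F p.2].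
have -> : #|vanishing_quadruples F| = (\sum_p #|D p|)%N.
  rewrite -sum1_card.
  under [in RHS]eq_bigr do rewrite -sum1_card.
  rewrite pair_big_dep /=.
  rewrite (reindex_onto
    (fun q : ('rV['F_2]_n * 'rV['F_2]_n) * 'rV['F_2]_n =>
       (q.1, (q.2, q.2 + (q.1.1 + q.1.2))))
    (fun t => (t.1, t.2.1))) /=; last first.
    move=> [[x y] [z w]]; rewrite inE /= => /andP[/eqP + _].
    move/eqP; rewrite addr_eq0 F2_oppr => /eqP ->.
    by rewrite addrA F2_addrr add0r.
  apply: eq_bigl => -[[x y] z]; rewrite !inE /= eqxx andbT.
  rewrite [z + (z + _)]addrA F2_addrr add0r F2_addrr eqxx /=.
  by rewrite F2_addr_eq0 eq_sym [F z + _]addrC.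
have row_bound x : (\sum_y #|D (x, y)| + 2 <= 3 * 2 ^ n)%N.
  rewrite (bigD1 x) //=.
  have Dxx : (#|D (x, x)| <= 2 ^ n)%N by rewrite -card_rV_F2 max_card.
  have Dxy : (\sum_(y | y != x) #|D (x, y)| <= \sum_(y : 'rV['F_2]_n | y != x) 2)%N.
    by apply: leq_sum => y yx; apply: F_APN; rewrite F2_addr_eq0 eq_sym.
  rewrite sum_nat_const card_neq_rV_F2 in Dxy.
  apply: leq_trans (leq_add (leq_add Dxx Dxy) (leqnn 2)) _.
  have q_gt0 : (0 < 2 ^ n)%N by rewrite expn_gt0.
  lia.
have -> : (\sum_p #|D p| = \sum_x \sum_y #|D (x, y)|)%N.
  by rewrite pair_bigA /=; apply: eq_bigr => -[].
have : (\sum_x (\sum_y #|D (x, y)| + 2) <= \sum_(x : 'rV['F_2]_n) 3 * 2 ^ n)%N.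
  exact: leq_sum.
rewrite big_split /= !sum_nat_const card_rV_F2; lia.
Qed.

(** Sum [5 * k <= k ^ 2 + 6] over the image: the fibre sizes [k] add up to [2 ^ n], their squares to
    the number of collisions. *)
Lemma card_collisions_ge n (F : 'rV['F_2]_n -> 'rV['F_2]_n) :
  (5 * 2 ^ n <= #|collisions F| + 6 * #|im_set F|)%N.
Proof.
pose k y := #|[set x | F x == y]|.
have sumk : (\sum_(y in im_set F) k y = 2 ^ n)%N.
  rewrite -card_rV_F2 -cardsT -sum1_card [RHS](partition_big_imset F) /=.
  by apply: eq_bigr => y _; rewrite sum1dep_card; apply: eq_card => x; rewrite !inE.
have -> : #|collisions F| = (\sum_(y in im_set F) k y * k y)%N.
  rewrite -sum1_card.
  transitivity (\sum_(x in [set: 'rV['F_2]_n]) k (F x))%N.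
    under [in RHS]eq_bigr do rewrite /k -sum1_card.
    rewrite pair_big_dep /=; apply: eq_bigl => p.
    by rewrite !inE eq_sym.
  rewrite [LHS](partition_big_imset F) /=; apply: eq_bigr => y _.
  rewrite (eq_bigr (fun=> k y)) => [|x /andP[_ /eqP->] //].
  rewrite sum_nat_const; congr (_ * _)%N.
  by rewrite /k; apply: eq_card => x; rewrite [LHS]unfold_in !inE.
rewrite -sumk -sum1_card !big_distrr -big_split /=.
by apply: leq_sum => y _; case: (k y) => [|[|[|j]]] //; nia.
Qed.

(** * Plateaued and balanced functions *)

Lemma is_plateaued_walsh n t (f : 'rV['F_2]_n -> 'F_2) a :
  is_plateaued t f -> walsh f a = 0 \/ walsh f a ^+ 2 = 2 ^+ (n + t).
Proof.
move=> /(_ a)[/eqP|eqW]; first by rewrite normr_eq0 intr_eq0 => /eqP; left.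
(* Squaring removes the possibly irrational root, so the equality descends to the integers. *)
right; apply: (@intr_inj algC).
have := congr1 (fun z => z ^+ 2) eqW.
by rewrite /= sqrtCK real_normK ?realz // !rmorphXn.
Qed.

Lemma walsh_component0 n (F : 'rV['F_2]_n -> 'rV['F_2]_n) a :
  walsh (component F 0) a = if a == 0 then 2 ^+ n else 0.
Proof.
rewrite walshE -sum_chi_dotp; apply: eq_bigr => x _.
by rewrite /component [dotp 0 _]dotpC dotp0 chi0 mul1r dotpC.
Qed.

Lemma balanced_walsh0 n (f : 'rV['F_2]_n -> 'F_2) : balanced f -> walsh f 0 = 0.
Proof.
rewrite /balanced => f_bal.
have -> : walsh f 0 = \sum_x ((f x == 0)%:R *+ 2 - 1).
  rewrite walshE; apply: eq_bigr => x _.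
  by rewrite dotpC dotp0 chi0 mulr1; case: (f x) => [[|[|c]] //= ?].
rewrite sumrB sumrMnl -natr_sum sumr_const card_rV_F2 -f_bal -sum1dep_card.
by rewrite natrM mulr_natl (big_mkcond (fun x => f x == 0)); apply: subrr.
Qed.

(** Pointwise [W ^ 4 = 2 ^ (n + t) * W ^ 2], as [W ^ 2] is 0 or [2 ^ (n + t)]; Parseval does the
    rest. *)
Lemma sum_walsh_pow4_plateaued n t (f : 'rV['F_2]_n -> 'F_2) :
  is_plateaued t f ->
  \sum_a walsh f a ^+ 4 = 2 ^+ (n + t) * (2 ^+ n * 2 ^+ n).
Proof.
move=> f_pl; rewrite -(parseval f) mulr_sumr; apply: eq_bigr => a _.
by rewrite (exprM _ 2 2) expr2; case: (is_plateaued_walsh a f_pl) => ->; rewrite ?mulr0.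
Qed.

Lemma balanced_plateaued_ge2 n t (f : 'rV['F_2]_n -> 'F_2) :
  ~~ odd n -> is_plateaued t f -> balanced f -> (2 <= t)%N.
Proof.
move=> n_even f_pl /balanced_walsh0 W0.
(* By Parseval the transform is not identically zero, so [2 ^ (n + t)] is attained and is a perfect
   square; this makes [t] even. *)
have [a Wa] : exists a, walsh f a ^+ 2 = 2 ^+ (n + t).
  case: (pickP (fun a => walsh f a != 0)) => [a Wa|W_eq0].
    by exists a; case: (is_plateaued_walsh a f_pl) Wa => ->; rewrite ?eqxx.
  have := parseval f; rewrite big1 => [/eqP|a _].
    by rewrite eq_sym mulf_eq0 !expf_eq0 andbF.
  by move/negbFE/eqP: (W_eq0 a) => ->.
have t_even : ~~ odd t.
  have : (`|walsh f a| ^ 2 = 2 ^ (n + t))%N.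
    by rewrite -abszX Wa abszX.
  move/(congr1 (logn 2)); rewrite lognX pfactorK // => nt.
  by have : ~~ odd (n + t); [rewrite -nt mul2n odd_double|rewrite oddD (negPf n_even)].
case: t => [|[|t]] // in f_pl t_even Wa *.
(* Only [t = 0] is left. Then [W ^ 2 <= 2 ^ n] everywhere and [W 0 = 0], so the sum of squares is at
   most [(2 ^ n - 1) * 2 ^ n], short of Parseval. *)
have := parseval f; rewrite (bigD1 0) //= W0 expr0n add0r => eq_sum.
have : \sum_(a | a != 0) walsh f a ^+ 2 <= \sum_(a : 'rV['F_2]_n | a != 0) 2 ^+ n.
  apply: ler_sum => c _; case: (is_plateaued_walsh c f_pl) => ->.
    by rewrite expr0n exprn_ge0.
  by rewrite addn0.
rewrite eq_sum sumr_const.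
rewrite card_neq_rV_F2 -[leRHS]mulr_natr ler_pM2l ?exprn_gt0 // -natrX ler_nat.
have q_gt0 : (0 < 2 ^ n)%N by rewrite expn_gt0.
lia.
Qed.

Theorem theorem6p8 (n : nat) (F : 'rV['F_2]_n -> 'rV['F_2]_n)
    (n_even : ~~ odd n) (F_plateaued : plateaued F) (F_APN : APN F)
    (card_im : (3 * #|im_set F| = 2 ^ n + 2)%N) :
  forall b : 'rV['F_2]_n, b != 0 -> ~ balanced (component F b).
Proof.
move=> b b0 b_bal.
(* The exponents are gathered into one function; at [c = 0] any value will do. *)
have [|s s_pl] := fin_all_exists (P := fun c s => c != 0 -> is_plateaued s (component F c)).
  by move=> c; case: (eqVneq c 0) => [|/F_plateaued[s ?]]; [exists 0%N|exists s].
have s_ge2 := balanced_plateaued_ge2 n_even (s_pl b b0) b_bal.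
pose q : int := 2 ^+ n.
have q_gt0 : 0 < q by rewrite exprn_gt0.
have sumA_le : \sum_(c | c != 0) 2 ^+ (n + s c) <= 2 * q * (q - 1).
  have := sum_walsh_pow4 F; rewrite (bigD1 0) //=.
  have -> : \sum_a walsh (component F 0) a ^+ 4 = q ^+ 4.
    rewrite (bigD1 0) //= big1 => [|a /negPf a0]; rewrite walsh_component0 ?a0 //.
    by rewrite eqxx addr0.
  under eq_bigr => c c0 do rewrite (sum_walsh_pow4_plateaued (s_pl c c0)).
  rewrite -mulr_suml -/q.
  have : #|vanishing_quadruples F|%:R + 2 * q <= 3 * (q * q).
    by rewrite /q -natrX -!natrM -natrD ler_nat card_vanishing_quadruples.
  (* The zero component contributes [q ^ 4], so [Q = q ^ 2 + S] after cancelling [q ^ 2]. *)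
  move: (\sum_(c | _) _) (#|_|%:R) => S Q QE /eqP.
  rewrite (_ : q ^+ 4 + S * (q * q) = (q * q) * (q * q + S)); last by ring.
  have qq0 : q * q != 0 by rewrite mulf_neq0 // gt_eqF.
  move/eqP/(mulfI qq0); nia.
have sumW_ge : 2 * q * (q - 2) <= \sum_(c | c != 0) walsh (component F c) 0 ^+ 2.
  have := sum_walsh0_sqr F; rewrite (bigD1 0) //= walsh_component0 eqxx -/q.
  (* By the image size, [5 * q - 6 * |Im F| = 5 * q - 2 * (q + 2) = 3 * q - 4]. *)
  have : 3 * q <= #|collisions F|%:R + 4.
    rewrite /q -natrX -natrM -natrD ler_nat.
    have := card_collisions_ge F; lia.
  move: (\sum_(c | _) _) (#|_|%:R) => S N; nia.
(* Every summand is nonnegative, and the one at [b] is all of [2 ^ (n + s b)]. *)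
have diff_ge : 2 ^+ (n + s b) <=
    \sum_(c | c != 0) (2 ^+ (n + s c) - walsh (component F c) 0 ^+ 2).
  rewrite (bigD1 b) //= (balanced_walsh0 b_bal) expr0n subr0 lerDl.
  apply: sumr_ge0 => c /andP[c0 _].
  by case: (is_plateaued_walsh 0 (s_pl c c0)) => ->; rewrite ?subrr // expr0n subr0 exprn_ge0.
have A_ge : q * 4 <= 2 ^+ (n + s b).
  by rewrite exprD ler_pM2l //; apply: (@le_trans _ _ (2 ^+ 2)); rewrite // ler_eXn2l.
rewrite sumrB in diff_ge.
(* The chain reads [4 * q <= 2 * q * (q - 1) - 2 * q * (q - 2) = 2 * q], impossible for [q > 0]. *)
have := le_trans (le_trans A_ge diff_ge) (lerB sumA_le sumW_ge).
by clear -q_gt0; move: q q_gt0 => r r_gt0; nia.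
Qed.
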